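(* Let $V$ be a vector space of arbitrary dimension over a field $\mathbb{K}$ and let $\mathcal{F}=\{\langle\cdot,\cdot\rangle_i\}_{i\in I}$ be a family of inner products on $V$. There is a subspace $W$ of $V$ (in fact, any complement $W$ of $\mathrm{rad}(\mathcal{F})$ in $V$ will do) such that $V=\mathrm{rad}(\mathcal{F})\oplus W$ with $\mathrm{rad}(\mathcal{F})$ and $W$ orthogonal relative to every $\langle\cdot,\cdot\rangle_i$. Moreover, the family of inner products $\mathcal{F}|_W=\{\langle\cdot,\cdot\rangle_i|_W\}_{i\in I}$ on $W$ satisfies $\mathrm{rad}(\mathcal{F}|_W)=0$, and $\mathcal{F}$ is simultaneously orthogonalizable if and only if $\mathcal{F}|_W$ is simultaneously orthogonalizable.
   Context: An inner product on a $\mathbb{K}$-vector space $V$ means a symmetric bilinear form $V\times V\to\mathbb{K}$ (possibly degenerate). The index set $I$ is nonempty. The radical of an inner product is $\mathrm{rad}(\langle\cdot,\cdot\rangle)=\{x\in V:\langle x,y\rangle=0\ \forall y\in V\}$, and the radical of the family is $\mathrm{rad}(\mathcal{F})=\bigcap_{i\in I}\mathrm{rad}(\langle\cdot,\cdot\rangle_i)$. A family is simultaneously orthogonalizable if there is a single (Hamel) basis $\{v_j\}$ of the space such that $\langle v_j,v_k\rangle_i=0$ whenever $j\neq k$, for every $i\in I$ (isotropic basis vectors are allowed). For a subspace $W\subseteq V$, $\langle\cdot,\cdot\rangle_i|_W$ denotes the restriction to $W\times W$, and $\mathrm{rad}(\mathcal{F}|_W)$ is computed inside $W$. *)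

(* Defs.v *)
From HB Require Import structures.
From mathcomp Require Import all_boot all_order all_algebra.
From mathcomp Require Import boolp.
Set Implicit Arguments.
Unset Strict Implicit.
Unset Printing Implicit Defensive.
Import GRing.Theory.
Local Open Scope ring_scope.

(* Membership in a radical is turned into a boolean by [`[< _ >]] so that      *)
(* radicals are subspaces in the sense of [submodClosed].                      *)
Definition radical (K : fieldType) (V : lmodType K) (f : {symmetric V})
  : {pred V} := fun x => `[< forall y : V, f x y = 0 >].

Definition family_radical (K : fieldType) (V : lmodType K) (I : Type)
  (F : I -> {symmetric V}) : {pred V} :=
  fun x => `[< forall i : I, x \in radical (F i) >].

Section FamilyRadicalSubspace.
Variables (K : fieldType) (V : lmodType K) (I : Type) (F : I -> {symmetric V}).

Fact family_radical_submod_closed : submod_closed (family_radical F).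
Proof.
split=> [|a x y /asboolP Fx /asboolP Fy]; apply/asboolP=> i; apply/asboolP=> z.
  by rewrite linear0l.
have /asboolP Fxi := Fx i; have /asboolP Fyi := Fy i.
by rewrite linearPl /= Fxi Fyi mulr0 addr0.
Qed.

HB.instance Definition _ := GRing.isSubmodClosed.Build K V (family_radical F)
  family_radical_submod_closed.

End FamilyRadicalSubspace.

Definition direct_sum (K : fieldType) (V : lmodType K) (U W : submodClosed V)
  : Prop :=
  (forall x : V, exists u w : V, [/\ u \in U, w \in W & x = u + w]) /\
  (forall x : V, x \in U -> x \in W -> x = 0).

Definition subspace_type (K : fieldType) (V : lmodType K) (W : submodClosed V)
  : Type := {x : V | x \in W}.

Section SubspaceType.
Variables (K : fieldType) (V : lmodType K) (W : submodClosed V).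
HB.instance Definition _ := SubType.on (subspace_type W).
HB.instance Definition _ := [Choice of subspace_type W by <:].
HB.instance Definition _ := [SubChoice_isSubLmodule of subspace_type W by <:].
End SubspaceType.

Definition restrict (K : fieldType) (V : lmodType K) (f : {symmetric V})
  (W : submodClosed V) : subspace_type W -> subspace_type W -> K :=
  fun x y => f (\val x) (\val y).

Section Restrict.
Variables (K : fieldType) (V : lmodType K) (f : {symmetric V}).
Variable W : submodClosed V.

Fact restrict_bilinear : bilinear_for
  (GRing.Scale.Law.clone _ _ *%R _) (GRing.Scale.Law.clone _ _ (idfun \; *%R) _)
  (restrict f (W := W)).
Proof.
have valP a (u v : subspace_type W) :
    \val (a *: u + v) = a *: \val u + \val v by exact: linearP.
by split=> x a u v; rewrite /restrict valP ?linearPl ?linearPr.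
Qed.

HB.instance Definition _ := bilinear_isBilinear.Build K (subspace_type W)
  (subspace_type W) K _ _ (restrict f (W := W)) restrict_bilinear.

Fact restrict_symmetric (x y : subspace_type W) :
  restrict f x y = (-1) ^+ false * idfun (restrict f y x).
Proof. by rewrite /restrict {1}hermC. Qed.

HB.instance Definition _ := isHermitianSesquilinear.Build K (subspace_type W)
  false idfun (restrict f (W := W)) restrict_symmetric.

End Restrict.

Definition family_restrict (K : fieldType) (V : lmodType K) (I : Type)
  (F : I -> {symmetric V}) (W : submodClosed V) :
  I -> {symmetric (subspace_type W)} :=
  fun i => restrict (F i) (W := W).

(* Every type carries a choiceType structure classically, so indexing by a     *)
(* choiceType is no restriction; independence forces v to be injective.        *)
Definition hamel_basis (K : fieldType) (V : lmodType K) (J : choiceType)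
  (v : J -> V) : Prop :=
  (forall (s : seq J) (c : J -> K), uniq s ->
     \sum_(j <- s) c j *: v j = 0 -> forall j, j \in s -> c j = 0) /\
  (forall x : V, exists (s : seq J) (c : J -> K),
     x = \sum_(j <- s) c j *: v j).

Definition simultaneously_orthogonalizable (K : fieldType) (V : lmodType K)
  (I : Type) (F : I -> {symmetric V}) : Prop :=
  exists (J : choiceType) (v : J -> V), hamel_basis v /\
    forall (i : I) (j k : J), j <> k -> F i (v j) (v k) = 0.

(* Main.v *)
(* Zorn's lemma gives every subspace U a basis modulo U, whose span is a
   complement of U. If the v_j form an orthogonal basis of V, then every
   isotropic v_j (for all forms at once) is orthogonal to all of V, and the
   remaining v_j form a basis modulo the radical; projecting these to W
   changes no value of the forms and yields an orthogonal basis of W.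
   Conversely, an orthogonal basis of W is completed by any basis of the
   radical. *)

Require Import Defs.
From HB Require Import structures.
From mathcomp Require Import all_boot all_order all_algebra.
From mathcomp Require Import boolp classical_sets.
Import GRing.Theory.
Local Open Scope ring_scope.

(** * Linear combinations and bases modulo a subspace *)

Section LinearCombinations.
Context {K : fieldType} {V : lmodType K} {J : choiceType}.
Implicit Types (v : J -> V) (c : J -> K) (s : seq J) (U : submodClosed V).

(** Coefficients of repeated entries of [s] are added up. This brings spanning lists, which may
    repeat indices, to the duplicate-free form that independence demands. *)
Lemma lincomb_widen v s c (s' : seq J) : uniq s' -> {subset s <= s'} ->
  exists c', \sum_(j <- s) c j *: v j = \sum_(j <- s') c' j *: v j.
Proof.
move=> us'; elim: s => [|a s IHs] ss'.
  by exists (fun=> 0); rewrite big_nil big1 // => j _; rewrite scale0r.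
have [|c' cE] := IHs; first by move=> j js; apply: ss'; rewrite inE js orbT.
exists (fun j => (if j == a then c a else 0) + c' j).
rewrite big_cons cE; under [RHS]eq_bigr do rewrite scalerDl.
rewrite big_split /=; congr (_ + _).
rewrite (bigD1_seq a) ?ss' ?mem_head //= eqxx big1 ?addr0 // => j /negPf ->.
by rewrite scale0r.
Qed.

Definition lin_span v : {pred V} :=
  fun x => `[< exists s c, x = \sum_(j <- s) c j *: v j >].

Lemma lin_spanP v x :
  reflect (exists s c, x = \sum_(j <- s) c j *: v j) (x \in lin_span v).
Proof. exact: asboolP. Qed.

Fact lin_span_submod_closed v : submod_closed (lin_span v).
Proof.
split=> [|a x y /lin_spanP[s [c ->]] /lin_spanP[t [d ->]]]; apply/lin_spanP.
  by exists [::], (fun=> 0); rewrite big_nil.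
have ust := undup_uniq (s ++ t).
have [|c' ->] := lincomb_widen v s c _ ust.
  by move=> j js; rewrite mem_undup mem_cat js.
have [|d' ->] := lincomb_widen v t d _ ust.
  by move=> j jt; rewrite mem_undup mem_cat jt orbT.
exists (undup (s ++ t)), (fun j => a * c' j + d' j).
rewrite scaler_sumr -big_split; apply: eq_bigr => j _ /=.
by rewrite scalerDl scalerA.
Qed.

HB.instance Definition _ v := GRing.isSubmodClosed.Build K V (lin_span v)
  (lin_span_submod_closed v).

(** The images of the [v j] form a basis of the quotient of [V] by [U], expressed without building
    the quotient. As [U] is a mere predicate, [pred1 0] is allowed and gives back Hamel bases. *)
Definition basis_modulo (U : {pred V}) v :=
  (forall s c, uniq s -> \sum_(j <- s) c j *: v j \in U ->
     forall j, j \in s -> c j = 0) /\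
  (forall x, exists s c, x - \sum_(j <- s) c j *: v j \in U).

Lemma hamel_basisE v : hamel_basis v <-> basis_modulo (pred1 0) v.
Proof.
split=> -[ind gen]; split.
- by move=> s c us /eqP; apply: ind.
- move=> x; have [s [c ->]] := gen x.
  by exists s, c; rewrite inE subrr.
- by move=> s c us s0; apply: (ind s) => //; rewrite inE s0.
- by move=> x; have [s [c /eqP/subr0_eq]] := gen x; exists s, c.
Qed.

Lemma lincomb_modulo (U : submodClosed V) v w s c :
  (forall j, v j - w j \in U) ->
  \sum_(j <- s) c j *: v j - \sum_(j <- s) c j *: w j \in U.
Proof.
move=> vw; rewrite -sumrB; apply: rpred_sum => j _.
by rewrite -scalerBr rpredZ.
Qed.

Lemma direct_sum_span U v : basis_modulo U v -> direct_sum U (lin_span v).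
Proof.
move=> [ind gen]; split=> [x|x xU /lin_spanP[s [c xE]]].
  have [s [c xsU]] := gen x.
  exists (x - \sum_(j <- s) c j *: v j), (\sum_(j <- s) c j *: v j).
  by rewrite subrK; split=> //; apply/lin_spanP; exists s, c.
have [|c' cE] := lincomb_widen v s c _ (undup_uniq s).
  by move=> j; rewrite mem_undup.
have c'0 : {in undup s, forall j, c' j = 0}.
  by apply: ind; rewrite ?undup_uniq // -cE -xE.
by rewrite xE cE big1_seq // => j /andP[_ /c'0 ->]; rewrite scale0r.
Qed.

End LinearCombinations.

(** * Existence of bases by Zorn's lemma *)

Section Existence.
Context {K : fieldType} {V : lmodType K}.
Implicit Types (U : submodClosed V) (D : set V).
Local Open Scope classical_set_scope.

(** Independence of a set of vectors rather than of an indexed family, so that inclusion provides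
    the order for Zorn's lemma. *)
Definition free_set_modulo (U : {pred V}) D := forall (s : seq V) (c : V -> K),
  uniq s -> {in s, forall x, D x} -> \sum_(x <- s) c x *: x \in U ->
  {in s, forall x, c x = 0}.

Lemma maximal_free_set (U : {pred V}) : exists D, free_set_modulo U D /\
  forall D', D `<` D' -> ~ free_set_modulo U D'.
Proof.
apply: Zorn_bigcup => F Ffree Ftot s c us sF.
(* A finite list of vectors from the union of a chain already lies in one member. The alternative
   [set0] serves the empty list, since the chain may be empty. *)
suff [D [FD|D0] sD] : exists2 D, F D \/ D = set0 & {in s, forall x, D x}.
- exact: Ffree us sD.
- by move=> _ x /sD; rewrite D0.
elim: s {us} sF => [|x s IHs] sF; first by exists set0; [right|].
have [D FD sD] : exists2 D, F D \/ D = set0 & {in s, forall x, D x}.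
  by apply: IHs => y ys; apply: sF; rewrite inE ys orbT.
have [E FE Ex] := sF x (mem_head _ _).
have [DE|ED] : D `<=` E \/ E `<=` D.
  by case: FD => [FD|->]; [exact: Ftot|left; exact: sub0set].
- exists E; first by left.
  by move=> y; rewrite inE => /predU1P[->//|/sD]; exact: DE.
- exists D => // y; rewrite inE => /predU1P[->|/sD//]; exact: ED.
Qed.

Lemma basis_modulo_exists U :
  exists (J : choiceType) (v : J -> V), basis_modulo U v.
Proof.
have [D [Dfree Dmax]] := maximal_free_set U.
exists {x : V | `[< D x >]}, val; split=> [s c us sU j js|x].
  (* [d] carries the coefficients from the index type to [V]; its default 0 is never met along
     [map val s]. *)
  pose d x := oapp c 0 (insub x).
  have dE i : d (val i) = c i by rewrite /d valK.
  rewrite -dE; apply: (Dfree (map val s)); rewrite ?map_f //.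
  - by rewrite map_inj_uniq //; exact: val_inj.
  - by move=> _ /mapP[i _ ->]; apply/asboolP/(valP i).
  - by rewrite big_map; under eq_bigr do rewrite dE.
(* If [x] is not generated modulo [U], then adding [x] to [D] gives a strictly larger free set,
   against maximality. *)
apply: contrapT => xspan; apply: (Dmax (x |` D)).
  split; first by move=> y Dy; right.
  move=> /(_ x (or_introl erefl)) Dx; apply: xspan.
  have Dx' : `[< D x >] by exact/asboolP.
  exists [:: exist _ x Dx'], (fun=> 1).
  by rewrite big_seq1 scale1r subrr rpred0.
move=> s c us sD.
have remD : {in rem x s, forall y, D y}.
  move=> y; rewrite mem_rem_uniq // inE => /andP[/eqP yx /sD].
  by case=> // /yx.
have [xs|/rem_id xs] := boolP (x \in s); last first.
  by rewrite xs in remD; exact: Dfree.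
rewrite (perm_big _ (perm_to_rem xs)) big_cons /= => sU.
have [cx0|cx0] := eqVneq (c x) 0.
  rewrite cx0 scale0r add0r in sU.
  have cr := Dfree _ c (rem_uniq x us) remD sU.
  move=> y ys; have [->//|yx] := eqVneq y x.
  by apply: cr; rewrite mem_rem_uniq // inE yx.
(* A relation with [c x] nonzero can be solved for [x], which puts [x] in the span of [D] modulo
   [U]. The list [t] is the rest of [s], read as indices. *)
case: xspan; pose t : seq {x : V | `[< D x >]} := pmap insub (rem x s).
have tE : map val t = rem x s.
  rewrite /t (pmap_filter (@insubK _ _ _)); apply/all_filterP/allP => y yr.
  by rewrite isSome_insub; apply/asboolP/remD.
exists t, (fun j => - ((c x)^-1 * c (val j))).
under eq_bigr do rewrite scaleNr -scalerA.
rewrite sumrN -scaler_sumr opprK -(big_map val xpredT (fun y => c y *: y)) tE.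
by rewrite -[X in X + _](scalerK cx0) -scalerDr rpredZ.
Qed.

End Existence.

Lemma hamel_basis_exists (K : fieldType) (V : lmodType K) :
  exists (J : choiceType) (v : J -> V), hamel_basis v.
Proof.
have U0 : submod_closed (pred1 (0 : V)).
  split=> [|a x y /eqP-> /eqP->]; rewrite !inE //.
  by rewrite scaler0 addr0.
pose U0c := GRing.isSubmodClosed.Build K V _ U0.
pose U : submodClosed V := HB.pack (pred1 0 : pred V) U0c.
have [J [v vU]] := basis_modulo_exists U.
by exists J, v; apply/hamel_basisE.
Qed.

(** * Passing bases between a complement, the quotient and the whole space *)

Section DirectSum.
Context {K : fieldType} {V : lmodType K} {U W : submodClosed V}.
Hypothesis UW : direct_sum U W.

Lemma val_lincomb (S : submodClosed V) (J : choiceType)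
    (w : J -> subspace_type S) s (c : J -> K) :
  \val (\sum_(j <- s) c j *: w j) = \sum_(j <- s) c j *: \val (w j).
Proof. by rewrite raddf_sum; apply: eq_bigr => j _; exact: linearZ. Qed.

(** [W] meets each class modulo [U] in exactly one vector, so representatives in [W] of a basis of
    the quotient form a basis of [W]. Replacing [v] by [w] changes a combination by an element of
    [U], and an element of both [U] and [W] is 0. *)
Lemma hamel_basis_complement (J : choiceType) (v : J -> V)
    (w : J -> subspace_type W) :
  (forall j, v j - \val (w j) \in U) -> basis_modulo U v -> hamel_basis w.
Proof.
move=> vw [ind gen]; have [_ UW0] := UW.
have vwU s c := lincomb_modulo U v (fun j => \val (w j)) s c vw.
split=> [s c us s0|x].
  apply: ind => //; have := vwU s c.
  by rewrite -val_lincomb s0 (raddf0 \val) subr0.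
have [s [c xU]] := gen (\val x); exists s, c.
apply/val_inj/subr0_eq/UW0; last exact: (valP (x - \sum_(j <- s) _)).
rewrite val_lincomb; have := rpredD xU (vwU s c).
by rewrite addrA subrK.
Qed.

Lemma basis_modulo_complement (J : choiceType) (w : J -> subspace_type W) :
  hamel_basis w -> basis_modulo U (fun j => \val (w j)).
Proof.
move=> [ind gen]; have [UWsum UW0] := UW; split=> [s c us sU|x].
  apply: ind => //; apply/val_inj/UW0; last exact: (valP (\sum_(j <- s) _)).
  by rewrite val_lincomb.
have [u [y [uU yW ->]]] := UWsum x.
have [s [c yE]] := gen (exist _ y yW); exists s, c.
by rewrite -val_lincomb -yE addrK.
Qed.

Lemma hamel_basis_sum (A B : choiceType) (u : A -> subspace_type U)
    (v : B -> V) : hamel_basis u -> basis_modulo U v ->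
  hamel_basis (fun j : A + B =>
    match j with inl a => \val (u a) | inr b => v b end).
Proof.
move=> [uind ugen] [vind vgen]; set b := fun j : A + B => _.
pose getl (j : A + B) := if j is inl a then Some a else None.
pose getr (j : A + B) := if j is inr a then Some a else None.
have getlK : ocancel getl inl by case.
have getrK : ocancel getr inr by case.
split=> [s c us|x].
  (* The combination is split by tag into a part in [U] and a part along [v]. *)
  have -> : \sum_(j <- s) c j *: b j =
      \val (\sum_(a <- pmap getl s) c (inl a) *: u a) +
      \sum_(a <- pmap getr s) c (inr a) *: v a.
    rewrite val_lincomb; elim: s {us} => [|[a|a] s IHs] /=.
    - by rewrite !big_nil addr0.
    - by rewrite !big_cons IHs addrA.
    - by rewrite !big_cons IHs addrCA.
  move=> s0.
  (* The part along [v] is the opposite of the part in [U], so independence modulo [U] kills its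
     coefficients first; what remains is a relation between the [u a]. *)
  have cr : {in pmap getr s, forall a, c (inr a) = 0}.
    apply: (vind _ (fun a => c (inr a))); first exact: pmap_uniq us.
    rewrite -(addr0_eq s0).
    exact: (valP (- \sum_(a <- pmap getl s) c (inl a) *: u a)).
  have cl : {in pmap getl s, forall a, c (inl a) = 0}.
    apply: (uind _ (fun a => c (inl a))); first exact: pmap_uniq us.
    apply: val_inj; rewrite raddf0 -[RHS]s0 [X in _ + X]big1_seq ?addr0 //.
    by move=> a /andP[_ /cr ->]; rewrite scale0r.
  move=> [a|a] js; [apply: cl|apply: cr]; rewrite mem_pmap;
    exact: (map_f _ js).
have [t [d xU]] := vgen x.
have [s [c yE]] := ugen (exist _ (x - \sum_(j <- t) d j *: v j) xU).
exists (map inl s ++ map inr t),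
  (fun j => match j with inl a => c a | inr a => d a end).
by rewrite big_cat !big_map -val_lincomb -yE /= subrK.
Qed.

End DirectSum.

(** * The radical and orthogonal bases *)

Section Radical.
Context {K : fieldType} {V : lmodType K} {I : Type} {F : I -> {symmetric V}}.

Lemma family_radicalP x :
  reflect (forall i y, F i x y = 0) (x \in family_radical F).
Proof.
apply: (iffP (asboolP _)) => [xF i y|xF i]; last exact/asboolP/xF.
by have /asboolP := xF i.
Qed.

Lemma symmetric_swap i x y : F i x y = F i y x.
Proof. by rewrite hermC expr0 mul1r. Qed.

Lemma family_radicalr i x y : y \in family_radical F -> F i x y = 0.
Proof. by move=> /family_radicalP yF; rewrite symmetric_swap. Qed.

(** Each form descends to the quotient by the radical; the two arguments are replaced one after the
    other. *)
Lemma eq_modulo_radical i x x' y y' : x - x' \in family_radical F ->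
  y - y' \in family_radical F -> F i x y = F i x' y'.
Proof.
move=> /family_radicalP xF yF; transitivity (F i x' y); apply/subr0_eq.
  by have := xF i y; rewrite linearBl.
by have := family_radicalr i x' _ yF; rewrite linearBr.
Qed.

Section OrthogonalBasis.
Variables (J : choiceType) (v : J -> V).
Hypotheses (vbasis : hamel_basis v)
  (vorth : forall i j k, j <> k -> F i (v j) (v k) = 0).

Lemma lincomb_orthogonal i s (c : J -> K) k : uniq s -> k \in s ->
  F i (\sum_(j <- s) c j *: v j) (v k) = c k * F i (v k) (v k).
Proof.
move=> us ks; rewrite linear_sumlz (bigD1_seq k) //= linearZl_LR.
rewrite big1 ?addr0 // => j /eqP jk.
by rewrite linearZl_LR /= vorth // mulr0.
Qed.

(** When [y] is expanded in the basis, orthogonality kills every term except those in [v k], and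
    isotropy kills these. *)
Lemma isotropic_radical k :
  (forall i, F i (v k) (v k) = 0) -> v k \in family_radical F.
Proof.
move=> vk0; apply/family_radicalP => i y; have [s [c ->]] := vbasis.2 y.
rewrite linear_sumr big1 // => j _; rewrite linearZr_LR /=.
by have [<-|/eqP kj] := eqVneq k j; rewrite ?vk0 ?vorth ?mulr0.
Qed.

Lemma basis_modulo_radical : basis_modulo (family_radical F)
  (fun j : {j | v j \notin family_radical F} => v (val j)).
Proof.
split=> [s c us /family_radicalP sF k ks|x].
  (* A form that is not isotropic at this basis vector, chosen depending on [k]. Pairing the
     relation with [v (val k)] under it isolates [c k] times a nonzero scalar. *)
  have [i vki] : exists i, F i (v (val k)) (v (val k)) <> 0.
    apply/existsNP => vk0; have := valP k.
    by rewrite isotropic_radical.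
  have := sF i (v (val k)); rewrite linear_sumlz (bigD1_seq k) //=.
  rewrite linearZl_LR big1 ?addr0 => [/eqP|j jk].
    by rewrite mulf_eq0 => /orP[/eqP|/eqP].
  have vjk : val j <> val k by move=> /val_inj/eqP; apply/negP.
  by rewrite linearZl_LR /= vorth ?mulr0.
have [s [c ->]] := vbasis.2 x.
(* [pmap insub] discards the indices whose vector lies in the radical; the discarded terms add up to
   an element of the radical. *)
exists (pmap insub s), (fun j => c (val j)).
elim: s => [|j s IHs] /=; first by rewrite !big_nil subrr rpred0.
rewrite big_cons; case: insubP => [k _ <-|] /=.
  by rewrite big_cons opprD addrACA subrr add0r.
by rewrite negbK -addrA => vjF; rewrite rpredD ?rpredZ.
Qed.

End OrthogonalBasis.

End Radical.

Theorem proposition2 (K : fieldType) (V : lmodType K) (I : Type)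
    (I_nonempty : inhabited I) (F : I -> {symmetric V}) :
  (exists W : submodClosed V, direct_sum (family_radical F) W) /\
  (forall W : submodClosed V, direct_sum (family_radical F) W ->
     [/\ forall (i : I) (x y : V),
           x \in family_radical F -> y \in W -> F i x y = 0,
         forall x : subspace_type W,
           x \in family_radical (family_restrict F W) <-> x = 0
       & simultaneously_orthogonalizable F <->
         simultaneously_orthogonalizable (family_restrict F W)]).
Proof.
split.
  have [J [v vF]] := basis_modulo_exists (family_radical F).
  by eexists; exact: direct_sum_span vF.
move=> W FW; have [FWsum FW0] := FW.
split=> [i x y /family_radicalP xF _ //|x|].
  split=> [/family_radicalP xFW|->]; last exact: rpred0.
  apply/val_inj/FW0; last exact: (valP x).
  (* A vector of [W] orthogonal to [W] is also orthogonal to the radical, hence to their sum [V]; so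
     it lies in both summands. *)
  apply/family_radicalP => i y; have [u [w [uF wW ->]]] := FWsum y.
  rewrite linearDr /= (family_radicalr i _ _ uF) add0r.
  exact: (xFW i (exist _ w wW)).
split=> [[J [v [vbasis vorth]]]|[J [w [wbasis worth]]]].
  have projW x : exists w : subspace_type W, x - \val w \in family_radical F.
    have [u [w [uF wW ->]]] := FWsum x.
    by exists (exist _ w wW); rewrite /= addrK.
  (* [p] is the projection onto [W] along the radical; only its congruence to the identity modulo
     the radical is used, not its linearity. *)
  have [p pF] := choice projW.
  exists {j | v j \notin family_radical F}, (fun j => p (v (val j))); split.
    apply: (hamel_basis_complement FW) (basis_modulo_radical _ _ vbasis vorth).
    by move=> j; exact: pF.
  move=> i j k jk; rewrite -[LHS](eq_modulo_radical _ _ _ _ _ (pF _) (pF _)).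
  by apply: vorth => /val_inj.
have [A [u ubasis]] :=
  hamel_basis_exists K (subspace_type (family_radical F)).
have bbasis :=
  hamel_basis_sum A J u _ ubasis (basis_modulo_complement FW J w wbasis).
exists (A + J)%type; eexists; split; first exact: bbasis.
(* Any pair with a radical vector is orthogonal whatever the basis chosen there; only pairs inside
   [W] call on [worth]. *)
move=> i [a|j] [b|k] ab //=; try by rewrite family_radicalr // (valP (u _)).
  by rewrite symmetric_swap family_radicalr // (valP (u _)).
by apply: worth => jk; apply: ab; rewrite jk.
Qed.
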